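(* There is an absolute constant $K$ such that for every code $C\subseteq\{0,1\}^m$ and every $\epsilon\in(0,1)$, there exists a $(1\pm\epsilon)$-sparsifier $\widetilde w$ of $C$ with respect to the all-ones weights $w\equiv 1$ with $|\operatorname{supp}(\widetilde w)|\le K\cdot \mathrm{CL}(C)\log^2(m)(\log\log m)^2/\epsilon^2$.
   Context: A chain of length $\ell$ in a code $C\subseteq\{0,1\}^m$ is a pair of injective maps $a:[\ell]\to[m]$ and $c:[\ell]\to C$ such that $c(i)_{a(i)}=1$ for all $i$, and $c(i)_{a(j)}=0$ for all $1\le i<j\le\ell$; the chain length $\mathrm{CL}(C)$ is the maximum length of a chain ($0$ if none exists). Given weights $w:[m]\to\mathbb{R}_{\ge0}$ and $\epsilon>0$, a $(1\pm\epsilon)$-sparsifier of $C$ with respect to $w$ is $\widetilde w:[m]\to\mathbb{R}_{\ge0}$ with $(1-\epsilon)\sum_i w(i)c_i\le\sum_i\widetilde w(i)c_i\le(1+\epsilon)\sum_i w(i)c_i$ for every $c\in C$; $\operatorname{supp}(\widetilde w)=\{i:\widetilde w(i)\neq0\}$. Logarithms are understood to be at least $1$, i.e. $\log x:=\max\{\log_2 x,1\}$. *)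

(* Defs.v *)
From HB Require Import structures.
From mathcomp Require Import all_boot all_order all_algebra.
From Stdlib Require Import Reals.
From mathcomp Require Import Rstruct.
Set Implicit Arguments. Unset Strict Implicit. Unset Printing Implicit Defensive.
Import Order.TTheory GRing.Theory Num.Theory.

Definition word (m : nat) := {ffun 'I_m -> bool}.
Definition code (m : nat) := {set word m}.

Definition is_chain (m l : nat) (C : code m)
    (a : {ffun 'I_l -> 'I_m}) (c : {ffun 'I_l -> word m}) : bool :=
  [&& injectiveb a, injectiveb c,
      [forall i : 'I_l, c i \in C],
      [forall i : 'I_l, c i (a i)] &
      [forall i : 'I_l, forall j : 'I_l, (val i < val j)%N ==> ~~ c i (a j)]].

Definition has_chain (m : nat) (C : code m) (l : nat) : bool :=
  [exists a : {ffun 'I_l -> 'I_m}, exists c : {ffun 'I_l -> word m}, is_chain C a c].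

(* Chain length: maximum length of a chain (0 if none). Any chain has length
   <= m since a is injective, so the max over l <= m is the global max. *)
Definition CL (m : nat) (C : code m) : nat :=
  \max_(l < m.+1 | has_chain C l) l.

Local Open Scope ring_scope.

Definition lg (x : R) : R := Num.max (ln x / ln 2) 1.

Definition is_sparsifier (m : nat) (C : code m) (w wt : 'I_m -> R) (eps : R) : Prop :=
  (forall i, 0 <= wt i) /\
  forall c, c \in C ->
    (1 - eps) * (\sum_(i < m) w i * (c i)%:R) <= \sum_(i < m) wt i * (c i)%:R /\
    \sum_(i < m) wt i * (c i)%:R <= (1 + eps) * (\sum_(i < m) w i * (c i)%:R).

Definition supp (m : nat) (wt : 'I_m -> R) : {set 'I_m} := [set i | wt i != 0].

(* Main.v *)
(** Read backwards, a chain is a greedy sequence: each new coordinate lies in the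
    support of a codeword that vanishes on all the coordinates chosen before.
    Hence the maximal length [rank F] of a greedy sequence, for [F] the family
    of supports, is at most the chain length, and it is superadditive:
    [rank] of the traces on [S] plus [rank] of the members vanishing on [S] is at
    most [rank F].

    Superadditivity plays the role of matroid contraction in Karger's cut
    counting. After discarding at most [d * rank F] coordinates, the remaining
    family [G] is dense: for every [R], the members avoiding [R] cover at least
    [d] times their rank. A dense family on [m] points satisfies
    [\sum_(A in G) z ^+ #|A| <= (1 + m * z ^+ d) ^+ rank G] for [0 < z <= 1],
    which is exactly the union bound needed to sample it with probability about
    [log m / (e ^+ 2 * d)].

    One such round splits a set of [n] coordinates into the discarded part and
    the sample, both of size [O(sqrt (n * n0))] where
    [n0 = rank F * log m / e ^+ 2] if [d] is chosen well. Iterating on both parts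
    [log (log m)] times, with error [e = eps / O(log (log m))] per round, leaves
    [O(log m)] parts of size [O(n0)]. *)

Require Import Defs.
From HB Require Import structures.
From mathcomp Require Import all_boot all_order all_algebra.
From Stdlib Require Import Reals.
From mathcomp Require Import Rstruct.
From mathcomp Require Import polyrcf lra ring zify ssrnat.
Set Implicit Arguments. Unset Strict Implicit. Unset Printing Implicit Defensive.
Import Order.TTheory GRing.Theory Num.Theory.
Local Open Scope ring_scope.
Local Arguments exp _%_ring_scope.
Local Arguments lg _%_ring_scope.

(** * Greedy sequences and the rank of a set family *)

Definition avoid (T : finType) (F : {set {set T}}) (R : {set T}) :=
  [set A in F | A \subset ~: R].

Definition trace (T : finType) (F : {set {set T}}) (S : {set T}) :=
  [set A :&: S | A in F].

(** Each pick restricts the family to the members missing it, so later picks are witnessed by sets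
    disjoint from all earlier ones. *)
Fixpoint picks (T : finType) (s : seq T) (F : {set {set T}}) : bool :=
  if s is x :: s' then (x \in cover F) && picks s' (avoid F [set x]) else true.

(** Picks never repeat, so capping the length at [#|T|] loses nothing. *)
Definition rank (T : finType) (F : {set {set T}}) : nat :=
  (\max_(l < #|T|.+1 | [exists t : l.-tuple T, picks t F]) l)%N.

Lemma in_cover (T : finType) (F : {set {set T}}) x :
  reflect (exists2 A, A \in F & x \in A) (x \in cover F).
Proof. exact: bigcupP. Qed.

Lemma avoid_sub (T : finType) (F : {set {set T}}) R : avoid F R \subset F.
Proof. by apply/subsetP => A; rewrite inE => /andP[]. Qed.

Lemma avoidS (T : finType) (F G : {set {set T}}) R :
  F \subset G -> avoid F R \subset avoid G R.
Proof.
by move/subsetP=> FG; apply/subsetP => A; rewrite !inE => /andP[/FG -> ->].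
Qed.

Lemma avoid_avoid (T : finType) (F : {set {set T}}) R R' :
  avoid (avoid F R) R' = avoid F (R :|: R').
Proof. by apply/setP => A; rewrite !inE -andbA setCU subsetI. Qed.

Lemma in_avoid1 (T : finType) (F : {set {set T}}) x A :
  (A \in avoid F [set x]) = (A \in F) && (x \notin A).
Proof. by rewrite inE subsetC sub1set inE. Qed.

Lemma coverS (T : finType) (F G : {set {set T}}) :
  F \subset G -> cover F \subset cover G.
Proof.
move/subsetP=> FG; apply/subsetP => x /in_cover[A AF xA].
by apply/in_cover; exists A => //; apply: FG.
Qed.

Lemma cover_trace (T : finType) (F : {set {set T}}) S :
  cover (trace F S) = cover F :&: S.
Proof.
apply/setP => x; rewrite inE; apply/in_cover/andP.
  move=> [_ /imsetP[A AF ->]]; rewrite inE => /andP[xA xS]; split=> //.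
  by apply/in_cover; exists A.
move=> [/in_cover[A AF xA] xS]; exists (A :&: S); last by rewrite inE xA.
exact: imset_f.
Qed.

Lemma trace_avoid (T : finType) (F : {set {set T}}) (S R : {set T}) :
  R \subset S -> avoid (trace F S) R = trace (avoid F R) S.
Proof.
move=> RS; apply/setP => B; rewrite inE; apply/andP/imsetP.
  move=> [/imsetP[A AF ->] AR]; exists A => //; rewrite inE AF /=.
  rewrite subsetC; apply/subsetP => x xR; rewrite inE.
  move: AR; rewrite subsetC => /subsetP/(_ x xR).
  by rewrite !inE (subsetP RS) // andbT.
move=> [A]; rewrite inE => /andP[AF AR] ->; split; first exact: imset_f.
by apply: subset_trans AR; apply: subsetIl.
Qed.

Lemma trace_trace (T : finType) (F : {set {set T}}) S S' :
  trace (trace F S) S' = trace F (S :&: S').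
Proof.
rewrite /trace -imset_comp; apply: eq_imset => A /=.
by rewrite setIA.
Qed.

Lemma picksS (T : finType) s (F G : {set {set T}}) :
  F \subset G -> picks s F -> picks s G.
Proof.
elim: s F G => //= x s IH F G FG /andP[xF pF].
rewrite (subsetP (coverS FG)) //=.
by apply: IH pF; apply: avoidS.
Qed.

Lemma picks_uniq (T : finType) s (F : {set {set T}}) :
  picks s F -> uniq s /\ {subset s <= cover F}.
Proof.
elim: s F => //= x s IH F /andP[xF /IH[us sF]]; split.
  rewrite us andbT; apply/negP => /sF /in_cover[A].
  by rewrite in_avoid1 => /andP[_ /negbTE->].
move=> y; rewrite inE => /predU1P[-> //|/sF].
exact/subsetP/coverS/avoid_sub.
Qed.

Lemma picks_size (T : finType) s (F : {set {set T}}) :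
  picks s F -> (size s <= #|T|)%N.
Proof. by move=> /picks_uniq[us _]; rewrite -(card_uniqP us) max_card. Qed.

(** All picks in [s] lie in [S], so the members of [F] vanishing on [S] survive them. *)
Lemma picks_cat (T : finType) s s' (F : {set {set T}}) S :
  picks s (trace F S) -> picks s' (avoid F S) -> picks (s ++ s') F.
Proof.
elim: s F => [|x s IH] F /=; first by move=> _; apply/picksS/avoid_sub.
rewrite cover_trace inE => /andP[/andP[-> xS] ps] ps' /=.
have xSS : [set x] \subset S by rewrite sub1set.
apply: IH; first by rewrite -trace_avoid.
by rewrite avoid_avoid (setUidPr xSS).
Qed.

Lemma picks_rank (T : finType) s (F : {set {set T}}) :
  picks s F -> (size s <= rank F)%N.
Proof.
move=> pF; have sT := picks_size pF.
pose i : 'I_#|T|.+1 := Ordinal (sT : (size s < #|T|.+1)%N).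
apply: (@leq_bigmax_cond _ _ (fun l : 'I_#|T|.+1 => l : nat) i).
by apply/existsP; exists (in_tuple s).
Qed.

Lemma rank_picks (T : finType) (F : {set {set T}}) :
  exists2 s, picks s F & size s = rank F.
Proof.
have c0 : (0 < #|[pred l : 'I_#|T|.+1 | [exists t : l.-tuple T, picks t F]]|)%N.
  by apply/card_gt0P; exists ord0; apply/existsP; exists [tuple].
have [l /existsP[t pt] e] := eq_bigmax_cond (fun l : 'I_#|T|.+1 => l : nat) c0.
by exists t => //; rewrite size_tuple -e.
Qed.

Lemma rankS (T : finType) (F G : {set {set T}}) :
  F \subset G -> (rank F <= rank G)%N.
Proof.
move=> FG; have [s ps <-] := rank_picks F.
exact/picks_rank/(picksS FG).
Qed.

(* A greedy sequence for the trace on [S] can be continued by any greedy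
   sequence for the members of [F] that vanish on [S]. *)
Lemma rank_superadditive (T : finType) (F : {set {set T}}) S :
  (rank (trace F S) + rank (avoid F S) <= rank F)%N.
Proof.
have [s ps <-] := rank_picks (trace F S).
have [s' ps' <-] := rank_picks (avoid F S).
by rewrite -size_cat; apply/picks_rank/(picks_cat ps ps').
Qed.

Lemma rank_trace (T : finType) (F : {set {set T}}) S :
  (rank (trace F S) <= rank F)%N.
Proof. exact: leq_trans (leq_addr _ _) (rank_superadditive F S). Qed.

Lemma rank_avoid1 (T : finType) (F : {set {set T}}) x :
  x \in cover F -> (rank (avoid F [set x]) < rank F)%N.
Proof.
move=> xF; have [s ps <-] := rank_picks (avoid F [set x]).
by apply: (@picks_rank _ (x :: s)); rewrite /= xF.
Qed.

Lemma rank_le_card (T : finType) (F : {set {set T}}) : (rank F <= #|T|)%N.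
Proof. by have [s /picks_size + <-] := rank_picks F. Qed.

(* Rank version of the Sauer-Shelah bound. *)
Lemma card_rank (T : finType) (F : {set {set T}}) (U : {set T}) :
  cover F \subset U -> (#|F| <= #|U|.+1 ^ rank F)%N.
Proof.
have [n] := ubnP #|U|; elim: n U F => // n IH U F + FU.
have monoX a e : (a ^ e <= a.+1 ^ e)%N.
  by case: e => // e; rewrite leq_exp2r.
have subU A : A \in F -> A \subset U.
  by move=> AF; apply: subset_trans FU; apply: bigcup_sup AF.
have [U0 _|[x xU]] := set_0Vmem U.
  rewrite U0 cards0 exp1n -(cards1 (@set0 T)); apply: subset_leq_card.
  by apply/subsetP => A /subU; rewrite U0 subset0 inE.
rewrite (cardsD1 x U) xU ltnS => Un.
(* Both [F0] and [H] consist of traces on [U :\ x], so their union has rank at most [rank F]; a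
   nonempty intersection has smaller rank, since [x] can be picked first. *)
pose F0 := avoid F [set x]; pose H := [set A :\ x | A in F :\: F0].
have F1x A : (A \in F :\: F0) = (A \in F) && (x \in A).
  by rewrite inE in_avoid1 negb_and negbK; case: (A \in F); rewrite ?andbF ?andbT.
have cH : #|H| = #|F :\: F0|.
  apply: card_in_imset => A B; rewrite !F1x => /andP[_ xA] /andP[_ xB] e.
  by rewrite -(setD1K xA) -(setD1K xB) e.
have cF : #|F| = (#|F0 :|: H| + #|F0 :&: H|)%N.
  by rewrite cardsUI cH -(cardsID F0 F) (setIidPr (avoid_sub _ _)).
have F0S A : A \in F -> x \notin A -> A :&: (U :\ x) = A.
  move=> /subU AU xA; apply/setIidPl/subsetP => y yA.
  by rewrite !inE (subsetP AU) // andbT; apply: contraNneq xA => <-.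
have UT : F0 :|: H \subset trace F (U :\ x).
  apply/subsetP => A; rewrite in_setU => /orP[|/imsetP[B]].
    rewrite in_avoid1 => /andP[AF xA].
    by rewrite -(F0S _ AF xA); apply: imset_f.
  rewrite F1x => /andP[BF xB] ->; suff -> : B :\ x = B :&: (U :\ x) by apply: imset_f.
  apply/setP => y; rewrite !inE; case: eqP => //= _; first by rewrite andbF.
  by have /subsetP/(_ y) := subU _ BF; case: (y \in B) => // ->.
have cU : cover (F0 :|: H) \subset U :\ x.
  by apply: subset_trans (coverS UT) _; rewrite cover_trace subsetIr.
have cI : cover (F0 :&: H) \subset U :\ x.
  by apply: subset_trans (coverS _) cU; apply: subset_trans (subsetIl _ _) (subsetUl _ _).
have rU : (#|F0 :|: H| <= #|U :\ x|.+1 ^ rank F)%N.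
  apply: leq_trans (IH _ _ Un cU) _; apply: leq_pexp2l => //.
  exact: leq_trans (rankS UT) (rank_trace _ _).
have [I0|[A]] := set_0Vmem (F0 :&: H).
  rewrite cF I0 cards0 addn0; apply: leq_trans rU _.
  exact: monoX.
rewrite inE => /andP[_ /imsetP[B]]; rewrite F1x => /andP[BF xB] _.
have xF : x \in cover F by apply/in_cover; exists B.
have rI := IH _ _ Un cI.
have := leq_ltn_trans (rankS (subsetIl F0 H)) (rank_avoid1 xF).
move: rU; rewrite cF; case: (rank F) => // r rU; rewrite ltnS => rr.
apply: (@leq_trans (#|U :\ x|.+1 ^ r * #|U :\ x|.+2)%N).
  rewrite mulnS -expnSr addnC; apply: leq_add => //.
  by apply: leq_trans rI _; rewrite leq_pexp2l.
by rewrite expnSr add1n leq_mul2r monoX ?orbT.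
Qed.

(** * From greedy sequences to chains *)

Lemma picks_nth (T : finType) x0 (s : seq T) (F : {set {set T}}) k :
  picks s F -> (k < size s)%N ->
  exists2 A, A \in F & nth x0 s k \in A /\
    forall j, (j < k)%N -> nth x0 s j \notin A.
Proof.
elim: s F k => //= x s IH F [|k] /andP[xF ps]; first last.
  rewrite ltnS => /(IH _ _ ps)[A]; rewrite in_avoid1 => /andP[AF xA] [kA jA].
  by exists A => //; split=> // -[|j] //=; rewrite ltnS => /jA.
by move=> _; have /in_cover[A AF xA] := xF; exists A.
Qed.

(** Adding [set0] changes no cover, hence not the rank; in the union bound it supplies a term equal
    to 1, which is then subtracted. *)
Definition supports (m : nat) (C : code m) : {set {set 'I_m}} :=
  set0 |: [set [set i | (c : word m) i] | c in C].

(** The word witnessing a pick vanishes on the earlier picks, which after reversal are the later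
    coordinates of the chain. *)
Lemma rank_le_CL (m : nat) (C : code m) : (rank (supports C) <= CL C)%N.
Proof.
have [s ps es] := rank_picks (supports C).
have := picks_size ps; rewrite card_ord -es => sm.
have [->//|s0] := posnP (size s).
have x0 : 'I_m by move: s0 sm; case: (s).
have pick_word (i : 'I_(size s)) : exists c : word m,
    [/\ c \in C, c (nth x0 s (rev_ord i)) &
        forall j, (j < rev_ord i)%N -> ~~ c (nth x0 s j)].
  have [A] := picks_nth x0 ps (ltn_ord (rev_ord i)).
  rewrite !inE => /predU1P[-> [] | /imsetP[c cC ->] [ci jc]]; first by rewrite inE.
  by exists c; split=> // [|j /jc]; rewrite ?inE // in ci *.
have [c cP] := fin_all_exists pick_word.
have cgt (i j : 'I_(size s)) : (i < j)%N -> ~~ c i (nth x0 s (rev_ord j)).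
  move=> ij; have [_ _] := cP i; apply => /=.
  by apply: ltn_sub2l; rewrite ?ltnS // (leq_ltn_trans ij).
apply: (@leq_bigmax_cond _ _ (fun l : 'I_m.+1 => l : nat) (Ordinal (sm : (size s < m.+1)%N))).
apply/existsP; exists [ffun i => nth x0 s (rev_ord i)].
apply/existsP; exists (finfun c); apply/and5P; split.
- apply/injectiveP => i j; rewrite !ffunE => /eqP.
  rewrite nth_uniq ?ltn_ord //; last by have [] := picks_uniq ps.
  by move/eqP/val_inj/rev_ord_inj.
- apply/injectiveP => i j; rewrite !ffunE => e; apply/val_inj.
  have [ij|ij|//] := ltngtP (val i) (val j).
    by have := cgt _ _ ij; rewrite e; have [_ ->] := cP j.
  by have := cgt _ _ ij; rewrite -e; have [_ ->] := cP i.
- by apply/forallP => i; rewrite ffunE; have [] := cP i.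
- by apply/forallP => i; rewrite !ffunE; have [] := cP i.
- by apply/forallP => i; apply/forallP => j; apply/implyP; rewrite !ffunE => /cgt.
Qed.

(** * Dense families *)

(** Quantifying over all [R] makes density pass to [avoid G R], as the induction in [dense_growth]
    requires. *)
Definition dense (T : finType) (d : nat) (G : {set {set T}}) :=
  forall R, (d * rank (avoid G R) <= #|cover (avoid G R)|)%N.

Lemma dense_avoid (T : finType) d (G : {set {set T}}) R :
  dense d G -> dense d (avoid G R).
Proof. by move=> dG R'; rewrite avoid_avoid. Qed.

Lemma dense_cover (T : finType) d (G : {set {set T}}) :
  dense d G -> (d * rank G <= #|cover G|)%N.
Proof.
suff {2 3}<- : avoid G set0 = G by apply.
by apply/setP => A; rewrite inE setC0 subsetT andbT.
Qed.

(* Take [S] minimizing [d * rank (trace F S) + #|P :\: S|]: if the density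
   condition failed at [R], removing [cover (avoid _ R)] from [S] would
   decrease this quantity, by superadditivity of the rank. *)
Lemma dense_trace (T : finType) d (F : {set {set T}}) (P : {set T}) :
  exists S : {set T},
    [/\ S \subset P, dense d (trace F S) & (#|P :\: S| <= d * rank F)%N].
Proof.
pose f (S : {set T}) := (d * rank (trace F S) + #|P :\: S|)%N.
have [S SP Smin] := arg_minnP (P := fun S : {set T} => S \subset P) f (subxx P).
exists S; split=> // [R|]; first last.
  have := Smin P (subxx P); rewrite /f setDv cards0 addn0.
  have : (d * rank (trace F P) <= d * rank F)%N by rewrite leq_mul2l rank_trace orbT.
  lia.
set G := trace F S; set U := cover _.
have US : U \subset S.
  by apply: subset_trans (coverS (avoid_sub _ _)) _; rewrite cover_trace subsetIr.
have := Smin (S :\: U) (subset_trans (subsetDl _ _) SP); rewrite /f.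
have -> : #|P :\: (S :\: U)| = (#|P :\: S| + #|U|)%N.
  rewrite setDDr (setIidPr (subset_trans US SP)) cardsU.
  suff -> : (P :\: S) :&: U = set0 by rewrite cards0 subn0.
  apply/setP => x; rewrite !inE; apply/negP => /andP[/andP[/negP xS _] xU].
  exact/xS/(subsetP US).
have -> : trace F (S :\: U) = trace G (S :\: U).
  by rewrite trace_trace (setIidPr (subsetDl _ _)).
have rs := rank_superadditive G (S :\: U).
(* A member avoiding [R] lies inside [U], so it misses [S :\: U]. *)
have : (rank (avoid G R) <= rank (avoid G (S :\: U)))%N.
  apply/rankS/subsetP => A AR; have AU : A \subset U by apply: bigcup_sup AR.
  rewrite inE (subsetP (avoid_sub _ _) _ AR) subsetC; apply/subsetP => x.
  by rewrite !inE => /andP[+ _]; apply/contraNN/(subsetP AU).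
rewrite -/G; nia.
Qed.

(** * The generating function of a dense family *)

(** Derivative of the right side minus the left side of [dense_growth]: [b] will be the excess of
    the cover over [d * rank G], and [f A] the number of covered points outside [A]. *)
Lemma horner_deriv_growth (K : rcfType) (I : finType) (P : pred I) (f : I -> nat)
    d b r (N z : K) :
  (('X^d + N%:P) ^+ r.+1 * 'X^b - \sum_(A | P A) 'X^(f A))^`().[z] =
  (z ^+ d + N) ^+ r * ((r.+1 * d)%:R * z ^+ (b + d.-1) +
    (z ^+ d + N) * b%:R * z ^+ b.-1) - \sum_(A | P A) (f A)%:R * z ^+ (f A).-1.
Proof.
rewrite derivB derivM deriv_exp derivD derivC !derivXn.
rewrite addr0 (raddf_sum (@deriv K)) -pred_Sn hornerD hornerN horner_sum.
congr (_ - _); last first.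
  by apply: eq_bigr => A _ /=; rewrite derivXn hornerMn !hornerE mulr_natl.
rewrite hornerD !hornerM !hornerMn !hornerM !hornerMn !horner_exp !hornerD.
rewrite !hornerXn !hornerC ?hornerX (exprS (z ^+ d + N)) (exprD z b) natrM.
move: (z ^+ d + N) (z ^+ d.-1) (z ^+ b) (z ^+ b.-1) => u v w x.
by move: (u ^+ r) => y; ring.
Qed.

(* In the variable [z = y^-1] this reads
   [\sum_(A in G) z ^+ #|A| <= (1 + #|T|%:R * z ^+ d) ^+ rank G]. At [y = 1] it
   is [card_rank]. Differentiating the left-hand side in [y] gives the sum over
   [i] in [cover G] of the left-hand sides for the members avoiding [i], whose
   rank is smaller; induction then bounds it by the derivative of the right-hand
   side, because [d * rank G <= #|cover G|]. *)
Lemma dense_growth (K : rcfType) (T : finType) d (G : {set {set T}}) (y : K) :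
  (0 < d)%N -> dense d G -> 1 <= y ->
  \sum_(A in G) y ^+ (#|cover G| - #|A|) <=
    (y ^+ d + #|T|%:R) ^+ rank G * y ^+ (#|cover G| - d * rank G).
Proof.
move=> d0; have [n] := ubnP #|G|; elim: n G y => // n IH G y + dG y1.
rewrite ltnS => Gn; set a := #|cover G|; set N : K := #|T|%:R.
have N0 : 0 <= N by rewrite ler0n.
have da := dense_cover dG; rewrite -/a in da.
have cardG : (#|G| <= #|T|.+1 ^ rank G)%N.
  apply: leq_trans (card_rank (subxx _)) _.
  by case: (rank G) => // e; rewrite leq_exp2r // ltnS max_card.
have [a0|a0] := posnP a.
  have r0 : rank G = 0%N by move: da; rewrite a0; nia.
  under eq_bigr do rewrite a0 sub0n expr0.
  rewrite r0 a0 !expr0 mulr1 sumr_const.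
  by move: cardG; rewrite r0 -(ler_nat K).
have [x0 x0G] : exists x, x \in cover G by apply/card_gt0P.
have [r er] : exists r, rank G = r.+1.
  by move: (rank_avoid1 x0G); case: (rank G) => // r _; exists r.
rewrite er in da cardG *; set b := (a - d * r.+1)%N.
pose p : {poly K} := ('X^d + N%:P) ^+ r.+1 * 'X^b - \sum_(A in G) 'X^(a - #|A|).
have p_at z : p.[z] = (z ^+ d + N) ^+ r.+1 * z ^+ b - \sum_(A in G) z ^+ (a - #|A|).
  rewrite /p !hornerE horner_sum; congr (_ - _); apply: eq_bigr => A _.
  by rewrite !hornerE.
(* [card_rank] gives [0 <= p.[1]], so monotonicity of [p] on [[1, y]] suffices. *)
suff : p.[1] <= p.[y].
  rewrite !p_at !expr1n mulr1 => H; rewrite -subr_ge0; apply: le_trans H.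
  under eq_bigr do rewrite expr1n.
  by rewrite sumr_const nat1r -natrX subr_ge0 ler_nat.
apply: (@ler_hornerW K 1 y) => //; rewrite ?in_itv /= ?lexx ?y1 //.
move=> z; rewrite in_itv /= => /andP[/ltW z1 _].
have z0 : 0 <= z by apply: le_trans z1.
have -> : p^`().[z] = (z ^+ d + N) ^+ r * ((r.+1 * d)%:R * z ^+ (b + d.-1) +
    (z ^+ d + N) * b%:R * z ^+ b.-1) - \sum_(A in G) (a - #|A|)%:R * z ^+ (a - #|A|).-1.
  exact: horner_deriv_growth.
(* The factor [a - #|A|] counts the covered points [i] outside [A]; exchange the sums. *)
have sum_avoid : \sum_(A in G) (a - #|A|)%:R * z ^+ (a - #|A|).-1 =
    \sum_(i in cover G) \sum_(A in avoid G [set i]) z ^+ (a.-1 - #|A|).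
  rewrite (exchange_big_dep (mem G)) /=; last first.
    by move=> i A _; rewrite in_avoid1 => /andP[].
  apply: eq_bigr => A AG; have -> : ((a - #|A|).-1 = a.-1 - #|A|)%N by lia.
  rewrite (eq_bigl (fun i => i \in cover G :\: A)); last first.
    by move=> i; rewrite in_avoid1 AG in_setD andbC.
  rewrite sumr_const cardsD (setIidPr _) ?mulr_natl //.
  exact: bigcup_sup AG.
have term i : i \in cover G -> \sum_(A in avoid G [set i]) z ^+ (a.-1 - #|A|) <=
    (z ^+ d + N) ^+ r * z ^+ (b + d.-1).
  move=> iG; set Gi := avoid G [set i]; set ai := #|cover Gi|.
  have ri : (rank Gi <= r)%N by rewrite -ltnS -er rank_avoid1.
  have sub : cover Gi \subset cover G :\ i.
    apply/subsetP => x /in_cover[A]; rewrite in_avoid1 => /andP[AG iA] xA.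
    rewrite !inE; apply/andP; split; first by apply: contraNneq iA => <-.
    by apply/in_cover; exists A.
  have aia : (ai <= a.-1)%N.
    by have := subset_leq_card sub; rewrite [a](cardsD1 i) iG.
  have dai : (d * rank Gi <= ai)%N := dense_cover (dense_avoid [set i] dG).
  have GiG : (#|Gi| < n)%N.
    apply: leq_trans Gn; apply/proper_card/properP; split; first exact: avoid_sub.
    by have /in_cover[A AG iA] := iG; exists A => //; rewrite in_avoid1 iA andbF.
  have -> : \sum_(A in Gi) z ^+ (a.-1 - #|A|) =
      z ^+ (a.-1 - ai) * \sum_(A in Gi) z ^+ (ai - #|A|).
    rewrite mulr_sumr; apply: eq_bigr => A AGi; rewrite -exprD; congr (_ ^+ _).
    have : (#|A| <= ai)%N by apply/subset_leq_card; apply: bigcup_sup AGi.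
    lia.
  apply: (@le_trans _ _ (z ^+ (a.-1 - ai) *
      ((z ^+ d + N) ^+ rank Gi * z ^+ (ai - d * rank Gi)))).
    rewrite ler_wpM2l ?exprn_ge0 //; apply: IH => //; exact: dense_avoid.
  rewrite mulrCA -exprD.
  (* Each of the [r - rank Gi] spare factors [z ^+ d] is at most [z ^+ d + N]. *)
  have -> : (a.-1 - ai + (ai - d * rank Gi) = d * (r - rank Gi) + (b + d.-1))%N.
    rewrite /b; nia.
  rewrite exprD mulrA ler_wpM2r ?exprn_ge0 // exprM.
  rewrite -[in leRHS](subnKC ri) exprD ler_wpM2l ?exprn_ge0 ?addr_ge0 ?exprn_ge0 //.
  by rewrite lerXn2r ?nnegrE ?addr_ge0 ?exprn_ge0 // lerDl.
rewrite subr_ge0 sum_avoid; apply: le_trans (ler_sum _ term) _.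
rewrite sumr_const -/a -[leLHS]mulr_natl.
rewrite mulrCA ler_wpM2l ?exprn_ge0 ?addr_ge0 ?exprn_ge0 //.
(* The share [r.+1 * d] matches the first term of the derivative exactly; the share [b] is absorbed
   by the second, as [z ^+ d <= z ^+ d + N]. *)
have -> : a = (r.+1 * d + b)%N by rewrite /b; lia.
rewrite natrD mulrDl lerD2l.
case: (b) => [|b']; first by rewrite !mul0r mulr0 mul0r.
rewrite addSnnS prednK // exprD /=.
rewrite [leRHS]mulrAC [leRHS]mulrC ler_wpM2l // [leLHS]mulrC.
by rewrite ler_wpM2r ?exprn_ge0 // lerDl.
Qed.

(** * Bounds on the real exponential *)

Lemma exp_gt0 (x : R) : 0 < exp x.
Proof. exact/RltP/exp_pos. Qed.

Lemma exp_0 : exp 0 = 1.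
Proof. exact: expR0. Qed.

Lemma expD (x y : R) : exp x * exp y = exp (x + y).
Proof. exact: expRD. Qed.

Lemma expX (x : R) n : exp x ^+ n = exp (n%:R * x).
Proof.
elim: n => [|n IH]; first by rewrite mul0r expR0.
by rewrite exprS IH expD -natr1; congr exp; ring.
Qed.

Lemma expN (x : R) : exp (- x) = (exp x)^-1.
Proof.
have e0 : exp x != 0 by rewrite gt_eqF ?exp_gt0.
by apply: (mulIf e0); rewrite expD addNr exp_0 mulVf.
Qed.

Lemma exp_ge1Dx (x : R) : 1 + x <= exp x.
Proof. exact/RleP/exp_ineq1_le. Qed.

Lemma exp_le (x y : R) : x <= y -> exp x <= exp y.
Proof.
move=> xy; rewrite -(subrK x y) -expD ler_peMl ?(ltW (exp_gt0 _)) //.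
by apply: le_trans (exp_ge1Dx _); rewrite lerDl subr_ge0.
Qed.

(** From [1 - x / 2 <= exp (- (x / 2))], [exp x] is at most the inverse of [(1 - x / 2) ^+ 2];
    comparing with the quadratic is then a polynomial inequality. *)
Lemma exp_le_quadratic (x : R) : - (1 / 4) <= x <= 1 / 4 -> exp x <= 1 + x + x ^+ 2.
Proof.
move=> /andP[x1 x2].
have e2 : exp x * exp (- (x / 2)) ^+ 2 = 1.
  by rewrite expX expD -[RHS]exp_0; congr exp; lra.
have q0 : 0 <= 1 - x / 2 by lra.
have q : (1 - x / 2) ^+ 2 <= exp (- (x / 2)) ^+ 2.
  by rewrite lerXn2r ?nnegrE ?(ltW (exp_gt0 _)) // exp_ge1Dx.
have s0 : 0 <= 1 + x + x ^+ 2 by nra.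
have s1 : 1 <= (1 - x / 2) ^+ 2 * (1 + x + x ^+ 2).
  have -> : (1 - x / 2) ^+ 2 * (1 + x + x ^+ 2) =
    1 + x ^+ 2 / 4 * (1 - 3 * x + x ^+ 2) by field.
  rewrite lerDl mulr_ge0 ?divr_ge0 ?sqr_ge0 //; nra.
apply: le_trans (ler_peMr (ltW (exp_gt0 x)) s1) _.
by rewrite mulrA ler_piMl // -[leRHS]e2 ler_wpM2l // ltW // exp_gt0.
Qed.

(** * Random subsets and tail bounds *)

(** The probability of drawing [X] when each point is kept independently with probability [p]. *)
Definition bernoulli (T : finType) (p : R) (X : {set T}) : R :=
  \prod_i (if i \in X then p else 1 - p).

Lemma bernoulli_ge0 (T : finType) (p : R) (X : {set T}) :
  0 <= p <= 1 -> 0 <= bernoulli p X.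
Proof.
move=> /andP[p0 p1]; apply: prodr_ge0 => i _.
by case: ifP => //; rewrite subr_ge0.
Qed.

Lemma bernoulli_mgf (T : finType) (p b : R) (A : {set T}) :
  \sum_(X in {set T}) bernoulli p X * b ^+ #|X :&: A| = (1 + p * (b - 1)) ^+ #|A|.
Proof.
transitivity (\prod_(i : T) (p * (if i \in A then b else 1) + (1 - p))).
  rewrite bigA_distr; apply: eq_bigr => X _.
  rewrite -prodr_const big_mkcond -big_split /=; apply: eq_bigr => i _.
  by rewrite inE; do 2 case: (_ \in _); rewrite ?mulr1.
rewrite -prodr_const [RHS]big_mkcond; apply: eq_bigr => i _.
by case: ifP => _; ring.
Qed.

Lemma bernoulli_sum (T : finType) (p : R) : \sum_(X in {set T}) bernoulli p X = 1.
Proof.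
have := bernoulli_mgf p 1 (@set0 T); rewrite subrr mulr0 addr0 expr1n => e.
by rewrite -[RHS]e; apply: eq_bigr => X _; rewrite expr1n mulr1.
Qed.

(** Rests on [1 + p * (exp t - 1) <= exp (p * (t + t ^+ 2))]. Here [c] is the threshold as a
    multiple of the mean; negative [t] serves the lower tail. *)
Lemma bernoulli_exp (T : finType) (p t c : R) (A : {set T}) :
  0 <= p <= 1 -> - (1 / 4) <= t <= 1 / 4 ->
  \sum_(X in {set T}) bernoulli p X * exp (t * (#|X :&: A|%:R - c * (p * #|A|%:R))) <=
    exp (p * #|A|%:R * (t + t ^+ 2 - t * c)).
Proof.
move=> /andP[p0 p1] t14.
have -> : \sum_(X in {set T}) bernoulli p X * exp (t * (#|X :&: A|%:R - c * (p * #|A|%:R))) =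
    exp (- (t * (c * (p * #|A|%:R)))) * (1 + p * (exp t - 1)) ^+ #|A|.
  rewrite -bernoulli_mgf mulr_sumr; apply: eq_bigr => X _.
  rewrite [RHS]mulrCA expX expD; congr (_ * exp _).
  ring.
apply: (@le_trans _ _ (exp (- (t * (c * (p * #|A|%:R)))) *
    exp (p * (t + t ^+ 2)) ^+ #|A|)).
  rewrite ler_wpM2l ?(ltW (exp_gt0 _)) //.
  have := exp_le_quadratic t14 => et.
  have et0 := exp_ge1Dx t.
  have pt : p * (exp t - 1) <= p * (t + t ^+ 2) by rewrite ler_wpM2l // lerBlDl addrA.
  have pe0 : 0 <= p * exp t by rewrite mulr_ge0 // ltW // exp_gt0.
  rewrite lerXn2r ?nnegrE ?(ltW (exp_gt0 _)) //; first last.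
    by apply: le_trans (exp_ge1Dx _); rewrite lerD2l.
  by rewrite mulrBr mulr1; lra.
rewrite expX expD; apply: exp_le.
rewrite le_eqVlt; apply/orP; left; apply/eqP; ring.
Qed.

(* Exponential moments with parameter [e / 4] and a union bound over [G]. *)
Lemma sampling (T : finType) (G : {set {set T}}) (p e : R) :
  0 <= p <= 1 -> 0 < e <= 1 ->
  \sum_(A in G) 2 * exp (- (3 / 16 * e ^+ 2 * p * #|A|%:R)) < 1 ->
  exists X : {set T}, forall A, A \in G ->
    (1 - e) * (p * #|A|%:R) <= #|X :&: A|%:R <= (1 + e) * (p * #|A|%:R).
Proof.
move=> p01 /andP[e0 e1] sum1.
pose good (X : {set T}) := [forall A in G,
  (1 - e) * (p * #|A|%:R) <= #|X :&: A|%:R <= (1 + e) * (p * #|A|%:R)].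
have [X /forall_inP gX|bad] := pickP good; first by exists X.
(* For [s = e / 4], [c = 1 + e] and for [s = - (e / 4)], [c = 1 - e], the value of
   [s + s ^+ 2 - s * c] is [- (3 / 16 * e ^+ 2)]. *)
pose U s c (X A : {set T}) := exp (s * (#|X :&: A|%:R - c * (p * #|A|%:R))).
have one X : 1 <= \sum_(A in G) (U (e / 4) (1 + e) X A + U (- (e / 4)) (1 - e) X A).
  have /negbT/forall_inPn[A AG] := bad X.
  rewrite negb_and -!ltNge => dev.
  have pos B : 0 <= U (e / 4) (1 + e) X B + U (- (e / 4)) (1 - e) X B.
    by rewrite addr_ge0 // ltW // exp_gt0.
  rewrite (bigD1 A) //= -[leLHS]addr0 lerD ?sumr_ge0 //.
  have e4 : 0 <= e / 4 by lra.
  case/orP: dev => dev.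
    rewrite -[leLHS]add0r lerD ?(ltW (exp_gt0 _)) // -[leLHS]exp_0.
    by apply: exp_le; rewrite mulNr oppr_ge0 mulr_ge0_le0 // subr_le0 ltW.
  rewrite -[leLHS]addr0 lerD ?(ltW (exp_gt0 _)) // -[leLHS]exp_0.
  by apply: exp_le; rewrite mulr_ge0 // subr_ge0 ltW.
(* If every [X] is bad, averaging [one] over [X] yields [1 < 1]. *)
have := lt_irreflexive (1 : R); rewrite -[X in X < _](bernoulli_sum T p).
rewrite (le_lt_trans _ sum1) //.
apply: (@le_trans _ _ (\sum_(X in {set T}) bernoulli p X *
    \sum_(A in G) (U (e / 4) (1 + e) X A + U (- (e / 4)) (1 - e) X A))).
  by apply: ler_sum => X _; rewrite ler_peMr // bernoulli_ge0.
under eq_bigr do rewrite mulr_sumr.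
rewrite exchange_big; apply: ler_sum => A _ /=.
under eq_bigr do rewrite mulrDr.
rewrite big_split mulrDl mul1r; apply: lerD.
  apply: le_trans (bernoulli_exp _ _ p01 _) _; first by lra.
  apply: exp_le; nra.
apply: le_trans (bernoulli_exp _ _ p01 _) _; first by lra.
apply: exp_le; nra.
Qed.

(** * One round of sampling *)

Lemma dense_generating (K : rcfType) (T : finType) d (G : {set {set T}}) (y : K) :
  (0 < d)%N -> dense d G -> 1 <= y ->
  \sum_(A in G) y ^- #|A| <= (1 + #|T|%:R * y ^- d) ^+ rank G.
Proof.
move=> d0 dG y1; have y0 : 0 < y := lt_le_trans ltr01 y1.
have yn0 k : y ^+ k != 0 by rewrite expf_neq0 ?gt_eqF.
rewrite -(ler_pM2l (exprn_gt0 #|cover G| y0)) mulr_sumr.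
have -> : \sum_(A in G) y ^+ #|cover G| * y ^- #|A| =
    \sum_(A in G) y ^+ (#|cover G| - #|A|).
  apply: eq_bigr => A AG; have AG' : (#|A| <= #|cover G|)%N.
    by apply/subset_leq_card; apply: bigcup_sup AG.
  by rewrite -[in LHS](subnK AG') exprD mulfK.
apply: le_trans (dense_growth d0 dG y1) _.
have -> : 1 + #|T|%:R * y ^- d = (y ^+ d + #|T|%:R) / y ^+ d.
  by rewrite mulrDl divff.
rewrite exprMn exprVn -exprM mulrCA -[in leRHS](subnK (dense_cover dG)) exprD mulfK //.
Qed.

Lemma rank0_cover (T : finType) (F : {set {set T}}) : rank F = 0%N -> cover F = set0.
Proof.
move=> r0; apply/setP => x; rewrite inE; apply/negP => /rank_avoid1.
by rewrite r0.
Qed.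

Lemma sampling_round (T : finType) (F : {set {set T}}) (P : {set T}) (d : nat) (p e : R) :
  (0 < d)%N -> 0 < p <= 1 -> 0 < e <= 1 -> set0 \in F -> (0 < #|T|)%N ->
  8 * #|T|%:R ^+ 2 <= exp (3 / 16 * e ^+ 2 * p) ^+ d ->
  exists S X : {set T},
    [/\ S \subset P, X \subset S, (#|P :\: S| <= d * rank F)%N,
        #|X|%:R <= 2 * p * #|P|%:R &
        forall A, A \in F ->
          (1 - e) * #|S :&: A|%:R <= p^-1 * #|X :&: A|%:R <= (1 + e) * #|S :&: A|%:R].
Proof.
move=> d0 /andP[p0 p1] e01 F0 T0 hd; have [e0 e1] := andP e01.
have [S [SP dG cS]] := dense_trace d F P; exists S.
set G := trace F S in dG.
have AG A : A \in F -> A :&: S \in G by move=> AF; apply: imset_f.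
(* At rank 0 all traces are empty and so is the sample; at positive rank, density yields
   [d <= #|S|]. *)
have [r0|rG] := posnP (rank G).
  exists set0; split=> //; rewrite ?sub0set ?cards0 ?mulr_ge0 ?(ltW p0) //.
  move=> A /AG AS; have : A :&: S \subset set0.
    by rewrite -(rank0_cover r0); apply: bigcup_sup AS.
  by rewrite subset0 => /eqP; rewrite setIC => ->; rewrite set0I cards0 !mulr0 lexx.
set y := exp _ in hd; have y1 : 1 <= y.
  by apply: le_trans (exp_ge1Dx _); rewrite lerDl !mulr_ge0 ?sqr_ge0 ?(ltW p0) //; lra.
have y0 : 0 < y := exp_gt0 _.
have T1 : 1 <= #|T|%:R :> R by rewrite ler1n.
have yd : y ^- d <= (8 * #|T|%:R ^+ 2)^-1.
  rewrite lef_pV2 ?posrE ?exprn_gt0 // mulr_gt0 ?exprn_gt0 // ?ltr0n //.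
have yd8 : y ^- d <= 1 / 8.
  apply: le_trans yd _; rewrite div1r lef_pV2 ?posrE ?mulr_gt0 ?exprn_gt0 ?ltr0n //.
  by rewrite ler_peMr // exprn_ege1.
have dS : (d <= #|S|)%N.
  have /subset_leq_card : cover G \subset S by rewrite cover_trace subsetIr.
  by apply: leq_trans; apply: leq_trans (dense_cover dG); rewrite leq_pmulr.
(* The rank is at most [#|T|] and [#|T|%:R ^+ 2 * y ^- d <= 1 / 8], so the sum is at most
   [exp (1 / 8)]. *)
have gen : \sum_(A in G) y ^- #|A| <= 1 + 9 / 64.
  apply: le_trans (dense_generating d0 dG y1) _.
  have x0 : 0 <= #|T|%:R * y ^- d by rewrite mulr_ge0 ?invr_ge0 ?exprn_ge0 ?(ltW y0).
  apply: (@le_trans _ _ (exp (#|T|%:R * y ^- d) ^+ #|T|)).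
    apply: (@le_trans _ _ ((1 + #|T|%:R * y ^- d) ^+ #|T|)).
      by apply: ler_weXn2l; rewrite ?lerDl // rank_le_card.
    by rewrite lerXn2r ?nnegrE ?addr_ge0 ?(ltW (exp_gt0 _)) // exp_ge1Dx.
  rewrite expX; apply: (@le_trans _ _ (exp (1 / 8))).
    apply: exp_le; apply: le_trans (ler_wpM2l _ (ler_wpM2l _ yd)) _ => //.
    have n0 : #|T|%:R != 0 :> R by rewrite pnatr_eq0 -lt0n.
    rewrite le_eqVlt; apply/orP; left; apply/eqP; field; exact: n0.
  apply: le_trans (exp_le_quadratic _) _; lra.
(* [S] joins the union bound to control the size of the sample; [set0], where both counts vanish,
   leaves it. *)
have [X XP] : exists X : {set T}, forall A, A \in (S |: G) :\ set0 ->
    (1 - e) * (p * #|A|%:R) <= #|X :&: A|%:R <= (1 + e) * (p * #|A|%:R).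
  apply: sampling => //; first by rewrite (ltW p0).
  have ey A : exp (- (3 / 16 * e ^+ 2 * p * #|A|%:R)) = y ^- #|A|.
    by rewrite expN /y expX; congr (exp _)^-1; ring.
  under eq_bigr do rewrite ey.
  rewrite -mulr_sumr.
  have ge0 A : 0 <= y ^- #|A| by rewrite invr_ge0 exprn_ge0 // ltW.
  have G0 : set0 \in G by rewrite -(set0I S); apply: AG.
  (* Without [set0] the bound [gen] leaves [9 / 64], and [S] adds at most [1 / 8]; twice the total
     is below 1. *)
  apply: (@le_lt_trans _ _ (2 * (y ^- #|S| + \sum_(A in G :\ set0) y ^- #|A|))).
    rewrite ler_wpM2l //.
    have -> : (S |: G) :\ set0 = S |: G :\ set0.
      apply/setP => A; rewrite !inE; case: (eqVneq A S) => //= ->.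
      by rewrite andbT -card_gt0 (leq_trans d0).
    have [SG|SG] := boolP (S \in G :\ set0); last by rewrite big_setU1.
    by rewrite (setUidPr _) ?sub1set // lerDr.
  have yS : y ^- #|S| <= y ^- d.
    by rewrite lef_pV2 ?posrE ?exprn_gt0 // ler_weXn2l.
  move: gen; rewrite (big_setD1 _ G0) /= cards0 expr0 invr1; lra.
exists (X :&: S).
have S0 : S \in (S |: G) :\ set0.
  by rewrite !inE eqxx /= andbT -card_gt0 (leq_trans d0 dS).
split=> //; first exact: subsetIr.
  have /andP[_ /le_trans] := XP _ S0; apply.
  rewrite mulrA ler_pM ?mulr_ge0 ?addr_ge0 ?(ltW p0, ltW e0) //.
    by rewrite ler_pM2r //; lra.
  by rewrite ler_nat subset_leq_card.
move=> A AF; have [A0|A0] := eqVneq (S :&: A) set0.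
  by rewrite -setIA A0 setI0 cards0 !mulr0 lexx.
have AS : A :&: S \in (S |: G) :\ set0 by rewrite 2!inE [A :&: S]setIC A0 inE -setIC AG // orbT.
have := XP _ AS; rewrite [A :&: S]setIC setIA.
rewrite [p^-1 * _]mulrC ler_pdivlMr // ler_pdivrMr //.
by rewrite !mulrA ![_ * _ * p]mulrAC.
Qed.

(** * Iterating the rounds *)

(** [a] counts the discarded points, [b] the sampled ones and [c] those that the sample represents,
    with [k] the inverse sampling rate. A round costs one factor [1 - e] or [1 + e]. *)
Lemma combine_bounds (K : realFieldType) (e u v k a b c x y : K) :
  0 <= e -> 0 <= u -> 0 <= v -> 0 <= k -> 0 <= a ->
  (1 - e) * c <= k * b <= (1 + e) * c -> u * b <= y <= v * b ->
  u * a <= x <= v * a ->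
  (1 - e) * u * (a + c) <= x + k * y <= (1 + e) * v * (a + c).
Proof.
move=> e0 u0 v0 k0 a0 /andP[X1 X2] /andP[Y1 Y2] /andP[Z1 Z2].
have lo := ler_wpM2l k0 Y1; have hi := ler_wpM2l k0 Y2.
have lo' := ler_wpM2l u0 X1; have hi' := ler_wpM2l v0 X2.
have ua : 0 <= e * (u * a) by rewrite !mulr_ge0.
have va : 0 <= e * (v * a) by rewrite !mulr_ge0.
by apply/andP; split; lra.
Qed.

(* [sampling_round] with [d] close to [sqrt (q * #|P| / rank F)] replaces [P] by
   two sets of size at most [2 * sqrt (q * rank F * #|P|)]. *)
Lemma sparsifier_rec (T : finType) (F : {set {set T}}) (q e : R) (r : nat) (P : {set T}) :
  0 < e <= 1 -> 1 <= q -> set0 \in F -> (0 < rank F)%N ->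
  8 * #|T|%:R ^+ 2 <= exp (3 / 16 * e ^+ 2 * q) ->
  #|P|%:R <= 4 * (q * (rank F)%:R) * 2 ^+ (2 ^ r) ->
  exists wt : T -> R,
    [/\ forall i, 0 <= wt i,
        #|[set i | wt i != 0]|%:R <= 2 ^+ r * (8 * (q * (rank F)%:R)) &
        forall A, A \in F ->
          (1 - e) ^+ r * #|P :&: A|%:R <= \sum_(i in A) wt i
            <= (1 + e) ^+ r * #|P :&: A|%:R].
Proof.
move=> e01 q1 F0 rF hq; set L : R := (rank F)%:R.
have [e0 e1] := andP e01.
have L1 : 1 <= L by rewrite ler1n.
have Q1 : 1 <= q * L by rewrite mulr_ege1.
have keep s (P' : {set T}) : #|P'|%:R <= 8 * (q * L) ->
  exists wt : T -> R,
    [/\ forall i, 0 <= wt i,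
        #|[set i | wt i != 0]|%:R <= 2 ^+ s * (8 * (q * L)) &
        forall A, A \in F ->
          (1 - e) ^+ s * #|P' :&: A|%:R <= \sum_(i in A) wt i
            <= (1 + e) ^+ s * #|P' :&: A|%:R].
  move=> P'Q; exists (fun i => (i \in P')%:R); split=> [i|| A AF]; first by rewrite ler0n.
    have -> : [set i | (i \in P')%:R != 0 :> R] = P'.
      by apply/setP => i; rewrite inE pnatr_eq0 eqb0 negbK.
    by apply: le_trans P'Q _; rewrite ler_peMl ?exprn_ege1 //; lra.
  have -> : \sum_(i in A) (i \in P')%:R = #|P' :&: A|%:R :> R.
    rewrite -sum1_card natr_sum big_mkcond [RHS]big_mkcond.
    by apply: eq_bigr => i _; rewrite inE; do 2 case: (_ \in _).
  rewrite ler_piMl ?ler0n ?exprn_ile1 //=; [|lra|lra].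
  by rewrite ler_peMl ?ler0n ?exprn_ege1 //; lra.
elim: r P => [|r IH] P; first by rewrite expn0 expr1 => hP; apply: keep; lra.
have [PQ _|] := lerP (#|P|%:R : R) (8 * (q * L)); first exact: keep.
(* Squaring [2 ^+ (2 ^ r)] increments [r], so reducing [#|P|] to about its geometric mean with
   [q * L] uses up one level. *)
move=> PQ hP; set M := 4 * (q * L) * 2 ^+ (2 ^ r) in IH.
have M0 : 0 <= M by rewrite !mulr_ge0 ?exprn_ge0 //; lra.
have hPM : 4 * (q * L) * #|P|%:R <= M ^+ 2.
  have -> : M ^+ 2 = 4 * (q * L) * (4 * (q * L) * 2 ^+ (2 ^ r.+1)).
    by rewrite /M !exprMn -exprM -expnSr; ring.
  by rewrite ler_wpM2l //; lra.
have L0 : 0 < L by lra.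
have q0 : 0 < q by lra.
(* This balances the two parts: for [d] near [s], the discarded points [d * L] and the sample
   [2 * (q / d) * #|P|] are both of order [s * L]. *)
pose s := Num.sqrt (q * #|P|%:R / L).
have s2 : s ^+ 2 * L = q * #|P|%:R.
  by rewrite sqr_sqrtr ?divr_ge0 ?mulr_ge0 ?ler0n ?ltW // divfK ?gt_eqF.
have s0 : 0 <= s := sqrtr_ge0 _.
have sq : q <= s.
  have : q ^+ 2 * L <= s ^+ 2 * L by rewrite s2; nra.
  by rewrite ler_pM2r // ler_sqr ?nnegrE // ltW.
have sM : 2 * s * L <= M.
  have sL0 : 0 <= 2 * s * L by rewrite !mulr_ge0 // ltW.
  rewrite -ler_sqr ?nnegrE //.
  apply: le_trans hPM; have -> : (2 * s * L) ^+ 2 = 4 * L * (s ^+ 2 * L) by ring.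
  rewrite s2; have -> : 4 * L * (q * #|P|%:R) = 4 * (q * L) * #|P|%:R by ring.
  by [].
(* Rounding up keeps [q <= s <= d], so [q / d] is a probability; [d <= 2 * s] because [s >= 1]. *)
pose d := (Num.truncn s).+1.
have sd : s <= d%:R by rewrite ltW // truncnS_gt.
have ds : d%:R <= 2 * s.
  rewrite /d -natr1; have := truncn_le s; rewrite s0 => H; lra.
have d0 : 0 < d%:R :> R by rewrite ltr0n.
have p01 : 0 < q / d%:R <= 1.
  by rewrite divr_gt0 //= ler_pdivrMr // mul1r (le_trans sq).
have T0 : (0 < #|T|)%N by apply: leq_trans rF (rank_le_card F).
have hd : 8 * #|T|%:R ^+ 2 <= exp (3 / 16 * e ^+ 2 * (q / d%:R)) ^+ d.
  rewrite expX; have -> : d%:R * (3 / 16 * e ^+ 2 * (q / d%:R)) = 3 / 16 * e ^+ 2 * q.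
    by field; rewrite gt_eqF.
  exact: hq.
have [S [X [SP XS cS cX hX]]] := sampling_round (F := F) P (ltn0Sn _) p01 e01 F0 T0 hd.
have [|w1 [w1_ge0 w1_supp w1P]] := IH (P :\: S).
  apply: le_trans sM; apply: (@le_trans _ _ (d%:R * L)).
    by rewrite -natrM ler_nat.
  by rewrite ler_wpM2r // ltW.
have [|w2 [w2_ge0 w2_supp w2X]] := IH X.
  apply: le_trans sM; apply: le_trans cX _.
  have -> : 2 * (q / d%:R) * #|P|%:R = 2 * (s ^+ 2 * L) / d%:R by rewrite s2; field; rewrite gt_eqF.
  rewrite ler_pdivrMr //.
  have -> : 2 * (s ^+ 2 * L) = 2 * s * L * s by ring.
  by rewrite ler_wpM2l // !mulr_ge0 // ltW.
set p := q / d%:R in p01 hX; have p0 : 0 < p by case/andP: p01.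
exists (fun i => w1 i + p^-1 * w2 i); split.
- by move=> i; rewrite addr_ge0 ?mulr_ge0 ?invr_ge0 ?(ltW p0).
- apply: (@le_trans _ _ (#|[set i | w1 i != 0]| + #|[set i | w2 i != 0]|)%:R).
    rewrite ler_nat; apply: leq_trans (leq_card_setU _ _); apply: subset_leq_card.
    apply/subsetP => i; rewrite !inE; apply: contraR; rewrite negb_or !negbK.
    by move=> /andP[/eqP-> /eqP->]; rewrite mulr0 addr0.
  rewrite natrD; apply: le_trans (lerD w1_supp w2_supp) _.
  by rewrite exprS -mulrA [leRHS]mulr_natl mulr2n.
move=> A AF; have := w1P A AF; have := w2X A AF; have := hX A AF.
rewrite big_split /= -mulr_sumr.
have -> : #|P :&: A|%:R = #|(P :\: S) :&: A|%:R + #|S :&: A|%:R :> R.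
  rewrite -natrD; congr _%:R; rewrite -(cardsID S (P :&: A)) addnC; congr (_ + _)%N.
    by apply: eq_card => i; rewrite !inE andbA.
  apply: eq_card => i; rewrite !inE.
  by have := subsetP SP i; case: (i \in S) => [->//|_]; rewrite ?andbT ?andbF.
set a : R := #|(P :\: S) :&: A|%:R; set c : R := #|S :&: A|%:R; set b : R := #|X :&: A|%:R.
set W1 := \sum_(_ in _) _; set W2 := \sum_(_ in _) _.
move=> hc hb ha; rewrite (exprS (1 - e)) (exprS (1 + e)).
by apply: combine_bounds hc hb ha;
  rewrite ?ler0n ?exprn_ge0 ?invr_ge0 ?subr_ge0 ?addr_ge0 ?(ltW p0) ?(ltW e0).
Qed.

(** * Logarithms and the number of rounds *)

Lemma lg_ge1 (x : R) : 1 <= lg x.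
Proof. by rewrite /lg le_max lexx orbT. Qed.

Lemma ln2_gt0 : 0 < ln 2.
Proof. exact/RltP/(Rlt_trans _ _ _ pos_half_prf ln_lt_2). Qed.

Lemma exp_ln2 : exp (ln 2) = 2 :> R.
Proof. by rewrite exp_ln; [rewrite -INRE | exact: Rlt_0_2]. Qed.


Lemma lg_ge_exponent (x : R) (k : nat) : 2 ^+ k <= x -> k%:R <= lg x.
Proof.
move=> kx; rewrite /lg le_max; apply/orP; left.
rewrite ler_pdivlMr ?ln2_gt0 //.
have x0 : 0 < x by apply: lt_le_trans kx; rewrite exprn_gt0.
rewrite leNgt; apply/negP => /RltP/exp_increasing; rewrite exp_ln; last exact/RltP.
move/RltP; rewrite ltNge; case/negP; apply: le_trans kx.
by rewrite -expX exp_ln2.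
Qed.

(** As [ln 2 <= 1], the binary logarithm dominates the natural one where the latter is at least 1;
    below that, the floor 1 of [lg] suffices. *)
Lemma le_exp_lg (x : R) : 0 < x -> x <= exp (lg x).
Proof.
move=> x0; have -> : x = exp (ln x) by rewrite exp_ln //; exact/RltP.
apply: exp_le; set y := ln x; rewrite /lg ln_exp.
have ln2_le1 : ln 2 <= 1 by have := exp_ge1Dx (ln 2); rewrite exp_ln2; lra.
rewrite le_max; have [y1|/ltW y1] := lerP y 1; first by rewrite orbT.
by rewrite ler_pdivlMr ?ln2_gt0 // ler_piMr // (le_trans ler01).
Qed.

Lemma lg_double (x : R) : 0 < x -> lg (2 * x) <= 1 + lg x.
Proof.
move=> x0; have -> : lg (2 * x) = Num.max (1 + ln x / ln 2) 1.
  have -> : 2 * x = exp (ln 2 + ln x) by rewrite -expD exp_ln2 exp_ln //; exact/RltP.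
  by rewrite /lg ln_exp mulrDl divff // gt_eqF ?ln2_gt0.
rewrite ge_max lerD2l le_max lexx /= lerDl.
exact: le_trans ler01 (lg_ge1 x).
Qed.

(** [k] is the binary logarithm of [n] rounded up. The real bound [x] allows a second application,
    to the exponent obtained from [m]. *)
Lemma exists_exponent (x : R) (n : nat) : n%:R <= x -> 1 <= x ->
  exists k : nat, [/\ (n <= 2 ^ k)%N, 2 ^+ k <= 2 * x & k%:R <= 2 * lg x].
Proof.
move=> nx x1; have l1 := lg_ge1 x.
have [n1|n1] := leqP n 1.
  by exists 0%N; rewrite expn0 expr0; split=> //; lra.
have /andP[lo hi] := up_log_bounds (isT : (1 < 2)%N) n1.
set k := up_log 2 n in lo hi; have k0 : (0 < k)%N by rewrite up_log_gt0.
have kx : 2 ^+ k.-1 <= x.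
  by apply: le_trans nx; rewrite -natrX ler_nat ltnW.
exists k; split=> //; first by rewrite -(prednK k0) exprS ler_pM2l.
by have := lg_ge_exponent kx; rewrite -{2}(prednK k0) -natr1; lra.
Qed.

Lemma bernoulli_inequality (x : R) n : 0 <= x <= 1 -> 1 - n%:R * x <= (1 - x) ^+ n.
Proof.
move=> /andP[x0 x1]; elim: n => [|n IH]; first by rewrite mul0r subr0 expr0.
rewrite exprS; have x1' : 0 <= 1 - x by lra.
apply: le_trans (ler_wpM2l x1' IH); rewrite -natr1.
have : 0 <= n%:R * (x * x) by rewrite !mulr_ge0.
lra.
Qed.

(** * From set families back to codes *)

Lemma sum_word (m : nat) (c : word m) (wt : 'I_m -> R) :
  \sum_(i < m) wt i * (c i)%:R = \sum_(i in [set i | c i]) wt i.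
Proof.
rewrite [RHS]big_mkcond; apply: eq_bigr => i _; rewrite inE.
by case: (c i); rewrite ?mulr1 ?mulr0.
Qed.

Theorem theorem4p1 :
  exists K : R, forall (m : nat) (C : code m) (eps : R), 0 < eps < 1 ->
    exists wt : 'I_m -> R,
      is_sparsifier C (fun _ => 1) wt eps /\
      (#|supp wt|%:R <= K * (CL C)%:R * (lg m%:R) ^+ 2 * (lg (lg m%:R)) ^+ 2 / eps ^+ 2).
Proof.
(* This is [4 * 8 * 32 * 16 * 5 ^+ 2], with factors from [2 ^+ r <= 4 * l], the part size in
   [sparsifier_rec], [q], [e ^+ 2] and [r%:R + 1 <= 5 * ll]. *)
exists (640 ^+ 2) => m C eps /andP[eps0 eps1].
set F := supports C; set l := lg m%:R; set ll := lg l.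
have l1 : 1 <= l := lg_ge1 _.
have ll1 : 1 <= ll := lg_ge1 _.
have F0 : set0 \in F by rewrite !inE eqxx.
have CF c : c \in C -> [set i | (c : word m) i] \in F.
  by move=> cC; rewrite inE imset_f ?orbT.
have rankCL : (rank F)%:R <= (CL C)%:R :> R by rewrite ler_nat rank_le_CL.
have [r0|rF] := posnP (rank F).
  exists (fun _ => 0); split; last first.
    have -> : supp (fun _ : 'I_m => 0) = set0.
      by apply/setP => i; rewrite !inE eqxx.
    by rewrite cards0 !mulr_ge0 ?exprn_ge0 ?invr_ge0 ?exprn_ge0 //; lra.
  split=> // c cC; rewrite !sum_word.
  have -> : [set i | c i] = set0.
    by apply/eqP; rewrite -subset0 -(rank0_cover r0); apply: bigcup_sup (CF c cC).
  by rewrite !big_set0 !mulr0 lexx.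
have m0 : (0 < m)%N by rewrite -(card_ord m) (leq_trans rF) ?rank_le_card.
have m1 : 1 <= m%:R :> R by rewrite ler1n.
have [k [mk _ kl]] := exists_exponent (lexx (m%:R : R)) m1.
rewrite -/l in kl.
have [|r [kr rl rll]] := exists_exponent kl; first by lra.
have {}rll : r%:R + 1 <= 5 * ll.
  by have := lg_double (lt_le_trans ltr01 l1); rewrite -/ll; lra.
(* The errors of [r] rounds add up to at most [eps / 4]; [r + 1] keeps the divisor positive at
   [r = 0]. *)
pose e := eps / (4 * (r%:R + 1)).
have r1 : 1 <= r%:R + 1 :> R by rewrite lerDr ler0n.
have e0 : 0 < e by rewrite divr_gt0 ?mulr_gt0 // ?ltr0n //; lra.
have re : r%:R * e <= eps / 4.
  rewrite /e mulrA ler_pdivrMr ?mulr_gt0 //; last by lra.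
  have : 0 <= r%:R * eps by rewrite mulr_ge0 // ltW.
  nra.
have e1 : e <= 1.
  rewrite /e ler_pdivrMr ?mulr_gt0 //; lra.
(* The sampling exponent becomes [6 * l], and [exp l] is at least both 2 and [m]. *)
pose q := 32 * l / e ^+ 2.
have q1 : 1 <= q.
  rewrite /q ler_pdivlMr ?exprn_gt0 // mul1r.
  apply: (@le_trans _ _ 1); first by rewrite exprn_ile1 // ltW.
  lra.
have hq : 8 * #|'I_m|%:R ^+ 2 <= exp (3 / 16 * e ^+ 2 * q).
  rewrite card_ord; have -> : 3 / 16 * e ^+ 2 * q = 6%:R * l by rewrite /q; field; rewrite gt_eqF.
  rewrite -expX (exprD _ 3 3); have el2 : 2 <= exp l.
    by apply: le_trans (exp_ge1Dx _); lra.
  have ml : m%:R <= exp l by apply: le_exp_lg; lra.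
  apply: ler_pM; rewrite ?exprn_ge0 //.
    have -> : 8 = 2 ^+ 3 :> R by ring.
    by rewrite lerXn2r ?nnegrE ?(ltW (exp_gt0 _)).
  apply: (@le_trans _ _ (exp l ^+ 2)); first by rewrite lerXn2r ?nnegrE ?(ltW (exp_gt0 _)).
  by apply: ler_weXn2l => //; lra.
have hm : #|[set: 'I_m]|%:R <= 4 * (q * (rank F)%:R) * 2 ^+ (2 ^ r).
  rewrite cardsT card_ord; apply: (@le_trans _ _ (2 ^+ (2 ^ r))).
    rewrite -natrX ler_nat; apply: leq_trans mk _.
    by rewrite leq_pexp2l.
  rewrite ler_peMl ?exprn_ge0 //.
  have : 1 <= q * (rank F)%:R by rewrite mulr_ege1 // ler1n.
  lra.
have e01 : 0 < e <= 1 by rewrite e0.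
have [wt [wt0 wts wtF]] := sparsifier_rec e01 q1 F0 rF hq hm.
exists wt; split.
  split=> // c cC; rewrite !sum_word.
  have -> : \sum_(i in [set i | c i]) 1 = #|[set: 'I_m] :&: [set i | c i]|%:R :> R.
    by rewrite sumr_const setTI.
  have /andP[lo hi] := wtF _ (CF c cC); split.
    apply: le_trans lo; rewrite ler_wpM2r //.
    have ee : 0 <= e <= 1 by rewrite ltW.
    apply: le_trans (bernoulli_inequality r ee); lra.
  apply: le_trans hi _; rewrite ler_wpM2r //.
  apply: (@le_trans _ _ (exp e ^+ r)).
    by rewrite lerXn2r ?nnegrE ?addr_ge0 ?(ltW (exp_gt0 _)) ?exp_ge1Dx // ltW.
  rewrite expX; apply: le_trans (exp_le re) _.
  apply: le_trans (exp_le_quadratic _) _; nra.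
rewrite /supp; apply: le_trans wts _.
have -> : 640 ^+ 2 * (CL C)%:R * l ^+ 2 * ll ^+ 2 / eps ^+ 2 =
    4 * l * (8 * (32 * l * (16 * (5 * ll) ^+ 2 / eps ^+ 2) * (CL C)%:R)).
  by field; rewrite gt_eqF.
have l0 : 0 <= l by lra.
have q0 : 0 <= q by lra.
have rl' : 2 ^+ r <= 4 * l by lra.
apply: ler_pM => //; first exact: exprn_ge0.
  by rewrite mulr_ge0 // mulr_ge0.
rewrite ler_pM2l //; apply: ler_pM => //.
rewrite /q ler_wpM2l ?mulr_ge0 //.
have -> : (e ^+ 2)^-1 = 16 * (r%:R + 1) ^+ 2 / eps ^+ 2.
  by rewrite /e; field; rewrite !gt_eqF //; lra.
rewrite ler_pM2r ?invr_gt0 ?exprn_gt0 // ler_pM2l //.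
by rewrite lerXn2r ?nnegrE //; lra.
Qed.
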